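(* Let $(X,A_1,\dots,A_n)$ satisfy condition $( * )$, let $p:X\to X/(A_1,\dots,A_n)$ be the quotient map, $a\in\bigcup_{i=1}^nA_i$ and $*=p(a)$. If $\pi_1^{top}(X,a)$ is compact and $\pi_1^{top}(X/(A_1,\dots,A_n),* )$ is Hausdorff, then $p_*:\pi_1^{top}(X,a)\to\pi_1^{top}(X/(A_1,\dots,A_n),* )$ is surjective, and it is a closed quotient map.
   Context: $X/(A_1,\dots,A_n)$ denotes the quotient space of $X$ by the equivalence relation generated by identifying all points of $A_i$ with each other for each $i$. $\pi_1^{top}(Y,y)$ is $\pi_1(Y,y)$ with the quotient topology with respect to the canonical surjection from the loop space $\Omega(Y,y)$ (based loops with the compact-open topology); $p_*$ is the induced continuous homomorphism. Condition $( * )$ on $(X,A_1,\dots,A_n)$ means one of: (i) $X$ is path connected and the $A_i$ are open subsets of $X$ whose closures are path connected; or (ii) $X$ is connected, locally path connected and first countable, and each $A_i$ is an open or closed subset of $X$, the closures $\overline{A_i}$ being path connected and pairwise disjoint. *)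

(* Defs.v *)
From Stdlib Require Import Reals Lra List Relations
  FunctionalExtensionality PropExtensionality ClassicalEpsilon.
Open Scope R_scope.

Record Top := mkTop {
  carrier :> Type;
  is_open : (carrier -> Prop) -> Prop;
  open_full : is_open (fun _ => True);
  open_inter : forall U V, is_open U -> is_open V -> is_open (fun x => U x /\ V x);
  open_union : forall F : (carrier -> Prop) -> Prop,
      (forall U, F U -> is_open U) -> is_open (fun x => exists U, F U /\ U x)
}.
Arguments is_open {t} _.

Definition continuous {X Y : Top} (f : X -> Y) : Prop :=
  forall U : Y -> Prop, is_open U -> is_open (fun x => U (f x)).

Lemma continuous_comp {X Y Z : Top} (f : X -> Y) (g : Y -> Z) :
  continuous f -> continuous g -> continuous (fun x => g (f x)).
Proof. intros Hf Hg U HU. exact (Hf _ (Hg U HU)). Qed.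

Definition is_closed {X : Top} (C : X -> Prop) : Prop := is_open (fun x => ~ C x).

Definition closure {X : Top} (A : X -> Prop) : X -> Prop :=
  fun x => forall C : X -> Prop, is_closed C -> (forall y, A y -> C y) -> C x.

Definition compact {X : Top} (K : X -> Prop) : Prop :=
  forall F : (X -> Prop) -> Prop,
    (forall U, F U -> is_open U) ->
    (forall x, K x -> exists U, F U /\ U x) ->
    exists l : list (X -> Prop),
      (forall U, In U l -> F U) /\ (forall x, K x -> exists U, In U l /\ U x).

Definition compact_space (X : Top) : Prop := compact (fun _ : X => True).

Definition hausdorff (X : Top) : Prop :=
  forall x y : X, x <> y ->
    exists U V : X -> Prop, is_open U /\ is_open V /\ U x /\ V y /\
      (forall z, ~ (U z /\ V z)).

Definition connected_space (X : Top) : Prop :=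
  forall U V : X -> Prop, is_open U -> is_open V ->
    (forall x, U x \/ V x) -> (forall x, ~ (U x /\ V x)) ->
    (exists x, U x) -> (exists x, V x) -> False.

Definition first_countable (X : Top) : Prop :=
  forall x : X, exists B : nat -> X -> Prop,
    (forall k, is_open (B k) /\ B k x) /\
    (forall U, is_open U -> U x -> exists k, forall y, B k y -> U y).

Inductive gen_open {T : Type} (B : (T -> Prop) -> Prop) : (T -> Prop) -> Prop :=
| go_basic : forall U, B U -> gen_open B U
| go_full : gen_open B (fun _ => True)
| go_inter : forall U V, gen_open B U -> gen_open B V ->
    gen_open B (fun x => U x /\ V x)
| go_union : forall F : (T -> Prop) -> Prop, (forall U, F U -> gen_open B U) ->
    gen_open B (fun x => exists U, F U /\ U x).

Definition gen_top (T : Type) (B : (T -> Prop) -> Prop) : Top :=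
  mkTop T (gen_open B) (go_full B) (go_inter B) (go_union B).

Definition prod_top (S T : Top) : Top :=
  gen_top (S * T) (fun W => exists (U : S -> Prop) (V : T -> Prop),
    is_open U /\ is_open V /\ W = (fun p => U (fst p) /\ V (snd p))).

Definition Icar : Type := {t : R | 0 <= t <= 1}.

Definition I_open (V : Icar -> Prop) : Prop :=
  forall t, V t -> exists eps, 0 < eps /\
    forall s : Icar, Rabs (proj1_sig s - proj1_sig t) < eps -> V s.

Lemma I_open_full : I_open (fun _ => True).
Proof. intros t _. exists 1. split; [lra | auto]. Qed.

Lemma I_open_inter : forall U V, I_open U -> I_open V -> I_open (fun x => U x /\ V x).
Proof.
  intros U V HU HV t [Ut Vt].
  destruct (HU t Ut) as [e1 [He1 H1]]. destruct (HV t Vt) as [e2 [He2 H2]].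
  exists (Rmin e1 e2). split. { apply Rmin_pos; assumption. }
  intros s Hs. split.
  - apply H1. apply Rlt_le_trans with (1 := Hs). apply Rmin_l.
  - apply H2. apply Rlt_le_trans with (1 := Hs). apply Rmin_r.
Qed.

Lemma I_open_union : forall F : (Icar -> Prop) -> Prop,
  (forall U, F U -> I_open U) -> I_open (fun x => exists U, F U /\ U x).
Proof.
  intros F HF t [U [FU Ut]].
  destruct (HF U FU t Ut) as [e [He H]].
  exists e. split; [exact He|]. intros s Hs. exists U. split; [exact FU| apply H; exact Hs].
Qed.

Definition Itop : Top := mkTop Icar I_open I_open_full I_open_inter I_open_union.

Definition I0 : Icar := exist _ 0 (conj (Rle_refl 0) Rle_0_1).
Definition I1 : Icar := exist _ 1 (conj Rle_0_1 (Rle_refl 1)).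

Definition path_connected_set {X : Top} (S : X -> Prop) : Prop :=
  forall x y, S x -> S y ->
    exists g : Itop -> X, continuous g /\ g I0 = x /\ g I1 = y /\
      (forall t, S (g t)).

Definition path_connected_space (X : Top) : Prop :=
  path_connected_set (fun _ : X => True).

Definition locally_path_connected (X : Top) : Prop :=
  forall (x : X) (U : X -> Prop), is_open U -> U x ->
    exists V : X -> Prop, is_open V /\ V x /\ (forall y, V y -> U y) /\
      path_connected_set V.

Definition eqcls {T : Type} (R : T -> T -> Prop) (x : T) : T -> Prop :=
  fun y => clos_refl_sym_trans T R x y.

Definition quot_type {T : Type} (R : T -> T -> Prop) : Type :=
  {S : T -> Prop | exists x, S = eqcls R x}.

Definition qproj {T : Type} (R : T -> T -> Prop) (x : T) : quot_type R :=
  exist _ (eqcls R x) (ex_intro _ x eq_refl).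

Definition qrep {T : Type} {R : T -> T -> Prop} (c : quot_type R) : T :=
  proj1_sig (constructive_indefinite_description _ (proj2_sig c)).

Section QuotTop.
Variables (X : Top) (R : X -> X -> Prop).

Definition quot_open (U : quot_type R -> Prop) : Prop :=
  is_open (fun x : X => U (qproj R x)).

Lemma quot_open_full : quot_open (fun _ => True).
Proof. apply open_full. Qed.

Lemma quot_open_inter : forall U V, quot_open U -> quot_open V ->
  quot_open (fun x => U x /\ V x).
Proof. intros U V HU HV. apply (open_inter X _ _ HU HV). Qed.

Lemma quot_open_union : forall F : (quot_type R -> Prop) -> Prop,
  (forall U, F U -> quot_open U) -> quot_open (fun x => exists U, F U /\ U x).
Proof.
  intros F HF. unfold quot_open.
  set (G := fun V : X -> Prop => exists U, F U /\ V = (fun x => U (qproj R x))).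
  assert (HG : forall V, G V -> is_open V).
  { intros V [U [FU ->]]. apply HF. exact FU. }
  pose proof (open_union X G HG) as H.
  replace (fun x : X => exists U, F U /\ U (qproj R x))
    with (fun x : X => exists V, G V /\ V x); [exact H|].
  apply functional_extensionality. intros x. apply propositional_extensionality.
  split.
  - intros [V [[U [FU ->]] HV]]. exists U. auto.
  - intros [U [FU HU]]. exists (fun x => U (qproj R x)). split; [|exact HU].
    exists U. auto.
Qed.

Definition quot_top : Top :=
  mkTop (quot_type R) quot_open quot_open_full quot_open_inter quot_open_union.

Lemma qproj_continuous : @continuous X quot_top (qproj R).
Proof. intros U HU. exact HU. Qed.

End QuotTop.

Definition collapse_rel (X : Top) (n : nat) (A : nat -> X -> Prop) : X -> X -> Prop :=
  fun x y => exists i, (i < n)%nat /\ A i x /\ A i y.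

Definition collapse_top (X : Top) (n : nat) (A : nat -> X -> Prop) : Top :=
  quot_top X (collapse_rel X n A).

Definition collapse_proj (X : Top) (n : nat) (A : nat -> X -> Prop) :
  X -> collapse_top X n A := qproj (collapse_rel X n A).

Record loop (Y : Top) (y : Y) := mkLoop {
  lpath : Itop -> Y;
  lcont : continuous lpath;
  lstart : lpath I0 = y;
  lend : lpath I1 = y
}.
Arguments lpath {Y y} _ _.

Definition loop_top (Y : Top) (y : Y) : Top :=
  gen_top (loop Y y) (fun W => exists (K : Itop -> Prop) (U : Y -> Prop),
    compact K /\ is_open U /\ W = (fun g => forall t, K t -> U (lpath g t))).

Definition loop_homotopic {Y : Top} {y : Y} (a b : loop Y y) : Prop :=
  exists H : Icar * Icar -> Y, @continuous (prod_top Itop Itop) Y H /\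
    (forall s, H (s, I0) = lpath a s) /\ (forall s, H (s, I1) = lpath b s) /\
    (forall t, H (I0, t) = y /\ H (I1, t) = y).

Definition pi1_top (Y : Top) (y : Y) : Top :=
  quot_top (loop_top Y y) loop_homotopic.

Definition comp_loop {X Y : Top} (f : X -> Y) (Hf : continuous f) (x : X) (y : Y)
  (Hfx : f x = y) (g : loop X x) : loop Y y :=
  mkLoop Y y (fun t => f (lpath g t))
    (continuous_comp (lpath g) f (lcont X x g) Hf)
    (eq_trans (f_equal f (lstart X x g)) Hfx)
    (eq_trans (f_equal f (lend X x g)) Hfx).

Definition pi1_map {X Y : Top} (f : X -> Y) (Hf : continuous f) (x : X) (y : Y)
  (Hfx : f x = y) : pi1_top X x -> pi1_top Y y :=
  fun c => qproj loop_homotopic (comp_loop f Hf x y Hfx (qrep c)).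

Definition collapse_pstar (X : Top) (n : nat) (A : nat -> X -> Prop) (a : X) :
  pi1_top X a -> pi1_top (collapse_top X n A) (collapse_proj X n A a) :=
  pi1_map (collapse_proj X n A) (qproj_continuous X (collapse_rel X n A))
    a (collapse_proj X n A a) eq_refl.

Definition surjective_map {X Y : Type} (f : X -> Y) : Prop := forall y, exists x, f x = y.

Definition closed_map {X Y : Top} (f : X -> Y) : Prop :=
  forall C : X -> Prop, is_closed C -> is_closed (fun y => exists x, C x /\ f x = y).

Definition quotient_map {X Y : Top} (f : X -> Y) : Prop :=
  surjective_map f /\
  (forall U : Y -> Prop, is_open U <-> is_open (fun x => U (f x))).

Definition condition_star (X : Top) (n : nat) (A : nat -> X -> Prop) : Prop :=
  (path_connected_space X /\
   (forall i, (i < n)%nat -> is_open (A i) /\ path_connected_set (closure (A i))))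
  \/
  (connected_space X /\ locally_path_connected X /\ first_countable X /\
   (forall i, (i < n)%nat -> (is_open (A i) \/ is_closed (A i)) /\
                              path_connected_set (closure (A i))) /\
   (forall i j, (i < n)%nat -> (j < n)%nat -> i <> j ->
      forall x, ~ (closure (A i) x /\ closure (A j) x))).

(* Main.v *)
(* The image of p_* is dense; being compact in a Hausdorff space it is then closed, hence
   everything, and a continuous map from a compact to a Hausdorff space is closed.
   For density, a loop g of the quotient is perturbed, within a given basic neighbourhood,
   to a loop homotopic to the projection of a loop of X.  The key point is that every
   open set meeting p(closure(A_i)) contains the point p(A_i), so the projection of a path
   in closure(A_i) is homotopic, rel endpoints, to the path that sits at p(A_i) except at
   its ends.  In case (ii), each point of the quotient has arbitrarily small neighbourhoods
   p(V), with V saturated and any two points of V joined by a path of X that projects into a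
   small set up to such a homotopy; a subdivision of g then suffices.  In case (i), p is
   open and the p(A_i) are open points: on a short interval the part of g between its first
   and last visit to p(A_i) is replaced by a constant, and away from these points g lifts
   to X. *)
From Stdlib Require Import Reals Lra Lia List Relations Classical
  FunctionalExtensionality PropExtensionality ClassicalEpsilon ProofIrrelevance.
Require Import Defs.
Open Scope R_scope.

(** * General topology: neighbourhoods, closures, closed and quotient maps *)

Lemma set_ext {T : Type} (U V : T -> Prop) : (forall x, U x <-> V x) -> U = V.
Proof.
  intros H. apply functional_extensionality. intros x.
  apply propositional_extensionality. apply H.
Qed.

Lemma open_of_nbhds {X : Top} (O : X -> Prop) :
  (forall x, O x -> exists N : X -> Prop, is_open N /\ N x /\ forall y, N y -> O y) ->
  is_open O.
Proof.
  intros H.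
  replace O with (fun x => exists U : X -> Prop,
    (is_open U /\ forall y, U y -> O y) /\ U x).
  - apply open_union. intros U [HU _]. exact HU.
  - apply set_ext. intros x. split.
    + intros [U [[_ HU] Ux]]. auto.
    + intros Ox. destruct (H x Ox) as [N [N1 [N2 N3]]]. exists N. auto.
Qed.

Lemma open_finite_inter {X : Top} (V : nat -> X -> Prop) (k : nat) :
  (forall j, (j < k)%nat -> is_open (V j)) ->
  is_open (fun x => forall j, (j < k)%nat -> V j x).
Proof.
  induction k as [|k IH]; intros H.
  - replace (fun x : X => forall j, (j < 0)%nat -> V j x) with (fun _ : X => True).
    + apply open_full.
    + apply set_ext. intros x. split; [intros _ j Hj; lia | auto].
  - replace (fun x : X => forall j, (j < S k)%nat -> V j x)
      with (fun x : X => (forall j, (j < k)%nat -> V j x) /\ V k x).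
    + apply open_inter; [apply IH; intros; apply H; lia | apply H; lia].
    + apply set_ext. intros x. split.
      * intros [H1 H2] j Hj. destruct (Nat.eq_dec j k) as [->|]; [exact H2 | apply H1; lia].
      * intros H1. split; [intros; apply H1; lia | apply H1; lia].
Qed.

Lemma closure_subset {X : Top} (A : X -> Prop) (x : X) : A x -> closure A x.
Proof. intros Ax C _ HC. auto. Qed.

Lemma closure_meets {X : Top} (A V : X -> Prop) (x : X) :
  closure A x -> is_open V -> V x -> exists y, A y /\ V y.
Proof.
  intros Hx HV Vx. apply NNPP. intros Hn.
  apply (Hx (fun y => ~ V y)); [|intros y Ay Vy; apply Hn; eauto|exact Vx].
  unfold is_closed. replace (fun x0 : X => ~ ~ V x0) with V; [exact HV|].
  apply set_ext. intros y. split; [tauto | apply NNPP].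
Qed.

Lemma open_compl_closure {X : Top} (A : X -> Prop) : is_open (fun x => ~ closure A x).
Proof.
  apply open_of_nbhds. intros x Hx.
  apply not_all_ex_not in Hx. destruct Hx as [C HC].
  apply imply_to_and in HC. destruct HC as [HC1 HC2].
  apply imply_to_and in HC2. destruct HC2 as [HC2 HC3].
  exists (fun y => ~ C y). split; [exact HC1|]. split; [exact HC3|].
  intros y Cy Hy. apply Cy. apply Hy; assumption.
Qed.

Lemma open_avoid_closures {X : Top} (A : nat -> X -> Prop) (n : nat) (J : nat -> Prop) :
  is_open (fun x => forall j, (j < n)%nat -> J j -> ~ closure (A j) x).
Proof.
  apply (open_finite_inter (fun j x => J j -> ~ closure (A j) x)).
  intros j _. destruct (classic (J j)) as [Hj|Hj].
  - replace (fun x : X => J j -> ~ closure (A j) x) with (fun x : X => ~ closure (A j) x).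
    + apply open_compl_closure.
    + apply set_ext. intros x. tauto.
  - replace (fun x : X => J j -> ~ closure (A j) x) with (fun _ : X => True).
    + apply open_full.
    + apply set_ext. intros x. tauto.
Qed.

(** For [y] outside the image of [C], cover [X] by the complement of [C] and the preimages of open
    sets separated from [y]. The opposite neighbourhoods of [y] from a finite subcover intersect in
    a neighbourhood that misses the image. *)
Lemma closed_map_of_compact_hausdorff {X Y : Top} (f : X -> Y) :
  continuous f -> compact_space X -> hausdorff Y -> closed_map f.
Proof.
  intros Hf HX HY C HC. apply open_of_nbhds. intros y Hy.
  set (F := fun W : X -> Prop => W = (fun x => ~ C x) \/
    exists U V : Y -> Prop, is_open U /\ is_open V /\ V y /\
      (forall z, ~ (U z /\ V z)) /\ W = (fun x => U (f x))).
  destruct (HX F) as [l [Hl1 Hl2]].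
  - intros W [->|[U [V [HU [_ [_ [_ ->]]]]]]]; [exact HC | apply Hf; exact HU].
  - intros x _. destruct (classic (C x)) as [Cx|Cx].
    + destruct (HY (f x) y) as [U [V [HU [HV [Ux [Vy HUV]]]]]].
      { intros E. apply Hy. eauto. }
      exists (fun z => U (f z)). split; [right; exists U, V; auto | exact Ux].
    + exists (fun x => ~ C x). split; [left; reflexivity | exact Cx].
  - assert (HN : exists N : Y -> Prop, is_open N /\ N y /\
      forall x, C x -> (exists W, In W l /\ W x) -> ~ N (f x)).
    { clear Hl2. induction l as [|W l IH].
      - exists (fun _ => True). split; [apply open_full|]. split; [exact I|].
        intros x _ [W [[] _]].
      - destruct IH as [N [N1 [N2 N3]]]; [intros; apply Hl1; right; assumption|].
        destruct (Hl1 W (or_introl eq_refl)) as [->|[U [V [HU [HV [Vy [HUV ->]]]]]]].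
        + exists N. split; [exact N1|]. split; [exact N2|].
          intros x Cx [W [[<-|HW] Wx]]; [contradiction | eauto].
        + exists (fun z => N z /\ V z). split; [apply open_inter; assumption|].
          split; [auto|].
          intros x Cx [W [[<-|HW] Wx]] [Nx Vx]; [apply (HUV (f x)); auto|].
          apply (N3 x Cx); eauto. }
    destruct HN as [N [N1 [N2 N3]]]. exists N. split; [exact N1|]. split; [exact N2|].
    intros z Nz [x [Cx <-]]. apply (N3 x Cx); auto.
Qed.

Lemma quotient_map_of_closed {X Y : Top} (f : X -> Y) :
  continuous f -> surjective_map f -> closed_map f -> quotient_map f.
Proof.
  intros Hf Hs Hc. split; [exact Hs|]. intros U. split; [apply Hf|].
  intros HU. specialize (Hc (fun x => ~ U (f x))).
  replace U with (fun y => ~ exists x, ~ U (f x) /\ f x = y).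
  - apply Hc. unfold is_closed.
    replace (fun x => ~ ~ U (f x)) with (fun x => U (f x)); [exact HU|].
    apply set_ext. intros x. split; [tauto | apply NNPP].
  - apply set_ext. intros y. split.
    + intros H. destruct (Hs y) as [x <-]. apply NNPP. intros Hn. apply H. eauto.
    + intros Uy [x [Hx <-]]. contradiction.
Qed.

(** * Generated equivalences and the induced map on fundamental groups *)

Lemma qproj_eq {T : Type} (R : T -> T -> Prop) (x y : T) :
  qproj R x = qproj R y <-> clos_refl_sym_trans T R x y.
Proof.
  split.
  - intros E. apply (f_equal (@proj1_sig _ _)) in E. simpl in E.
    change (eqcls R x y). rewrite E. apply rst_refl.
  - intros H. unfold qproj. apply subset_eq_compat. apply set_ext. intros z.
    split; intros Hz; [apply rst_trans with x; [apply rst_sym|] | apply rst_trans with y]; auto.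
Qed.

Lemma qproj_qrep {T : Type} (R : T -> T -> Prop) (c : quot_type R) : qproj R (qrep c) = c.
Proof.
  unfold qrep. destruct (constructive_indefinite_description _ _) as [x Hx]. simpl.
  destruct c as [S HS]. simpl in Hx. apply subset_eq_compat. symmetry. exact Hx.
Qed.

Lemma comp_loop_homotopic {X Y : Top} (f : X -> Y) (Hf : continuous f) (x : X) (y : Y)
  (Hfx : f x = y) (l m : loop X x) :
  loop_homotopic l m -> loop_homotopic (comp_loop f Hf x y Hfx l) (comp_loop f Hf x y Hfx m).
Proof.
  intros [H [Hc [H0 [H1 He]]]]. exists (fun q => f (H q)). split.
  - exact (@continuous_comp (prod_top Itop Itop) X Y H f Hc Hf).
  - simpl. split; [intros; f_equal; auto|]. split; [intros; f_equal; auto|].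
    intros t. rewrite (proj1 (He t)), (proj2 (He t)). auto.
Qed.

(** [pi1_map] is computed on a chosen representative. Composition with [f] respects the equivalence
    generated by homotopy, so any representative may be used. *)
Lemma pi1_map_qproj {X Y : Top} (f : X -> Y) (Hf : continuous f) (x : X) (y : Y)
  (Hfx : f x = y) (l : loop X x) :
  pi1_map f Hf x y Hfx (qproj loop_homotopic l) =
  qproj loop_homotopic (comp_loop f Hf x y Hfx l).
Proof.
  assert (H : forall l m : loop X x, clos_refl_sym_trans _ loop_homotopic l m ->
    clos_refl_sym_trans _ loop_homotopic
      (comp_loop f Hf x y Hfx l) (comp_loop f Hf x y Hfx m)).
  { intros l1 l2 H. induction H as [l1 l2 H|l1|l1 l2 _ IH|l1 l2 l3 _ IH1 _ IH2].
    - apply rst_step, comp_loop_homotopic, H.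
    - apply rst_refl.
    - apply rst_sym, IH.
    - eapply rst_trans; eassumption. }
  unfold pi1_map. apply qproj_eq, H, qproj_eq, qproj_qrep.
Qed.

Lemma comp_loop_continuous {X Y : Top} (f : X -> Y) (Hf : continuous f) (x : X) (y : Y)
  (Hfx : f x = y) :
  @continuous (loop_top X x) (loop_top Y y) (comp_loop f Hf x y Hfx).
Proof.
  intros O HO. induction HO as [O HO| |U V _ IHU _ IHV|F _ IH].
  - destruct HO as [K [U [HK [HU ->]]]]. apply go_basic.
    exists K, (fun z => U (f z)). split; [exact HK|]. split; [apply Hf, HU | reflexivity].
  - apply go_full.
  - apply (go_inter _ _ _ IHU IHV).
  - apply (@open_of_nbhds (loop_top X x)). intros g [U [FU Ug]].
    exists (fun g => U (comp_loop f Hf x y Hfx g)).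
    split; [apply IH, FU|]. split; [exact Ug|]. intros h Uh. exists U. auto.
Qed.

Lemma pi1_map_continuous {X Y : Top} (f : X -> Y) (Hf : continuous f) (x : X) (y : Y)
  (Hfx : f x = y) : continuous (pi1_map f Hf x y Hfx).
Proof.
  intros U HU. change (is_open (t := loop_top X x)
    (fun l => U (pi1_map f Hf x y Hfx (qproj loop_homotopic l)))).
  replace (fun l : loop_top X x => U (pi1_map f Hf x y Hfx (qproj loop_homotopic l)))
    with (fun l : loop_top X x => U (qproj loop_homotopic (comp_loop f Hf x y Hfx l))).
  - apply (comp_loop_continuous f Hf x y Hfx _ HU).
  - apply functional_extensionality. intros l. rewrite pi1_map_qproj. reflexivity.
Qed.

(** * Paths and homotopies over real intervals *)

Lemma clamp_proof (t : R) : 0 <= Rmax 0 (Rmin 1 t) <= 1.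
Proof.
  split; [apply Rmax_l|]. apply Rmax_lub; [lra | apply Rmin_l].
Qed.

(** Retraction of the line onto the unit interval; it turns maps on [Icar] into functions of a real
    variable. *)
Definition clamp (t : R) : Icar := exist _ (Rmax 0 (Rmin 1 t)) (clamp_proof t).

Lemma Icar_eq (s t : Icar) : proj1_sig s = proj1_sig t -> s = t.
Proof.
  destruct s, t. simpl. intros E. apply subset_eq_compat, E.
Qed.

Lemma clamp_in (t : R) : 0 <= t <= 1 -> proj1_sig (clamp t) = t.
Proof.
  intros Ht. simpl. rewrite Rmin_right by lra. apply Rmax_right. lra.
Qed.

Lemma clamp_proj (t : Icar) : clamp (proj1_sig t) = t.
Proof. apply Icar_eq, clamp_in, (proj2_sig t). Qed.

Lemma clamp_lipschitz (s t : R) :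
  Rabs (proj1_sig (clamp s) - proj1_sig (clamp t)) <= Rabs (s - t).
Proof.
  simpl. unfold Rmax, Rmin, Rabs. destruct (Rle_dec 1 s), (Rle_dec 1 t);
  repeat (match goal with |- context [Rle_dec ?a ?b] => destruct (Rle_dec a b) end);
  repeat (match goal with |- context [Rcase_abs ?a] => destruct (Rcase_abs a) end); lra.
Qed.

Lemma clamp_nbhd {X : Top} (g : Itop -> X) (t : R) (U : X -> Prop) :
  continuous g -> is_open U -> U (g (clamp t)) ->
  exists d, 0 < d /\ forall s, Rabs (s - t) < d -> U (g (clamp s)).
Proof.
  intros Hg HU Ut. destruct (Hg U HU (clamp t) Ut) as [d [Hd H]].
  exists d. split; [exact Hd|]. intros s Hs. apply H.
  apply Rle_lt_trans with (2 := Hs). apply clamp_lipschitz.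
Qed.

(** Relative continuity on the interval from [u] to [v] of a function on all of [R]. Restriction and
    gluing then need no subtypes. *)
Definition path_on {X : Top} (u v : R) (f : R -> X) : Prop :=
  forall t (U : X -> Prop), u <= t <= v -> is_open U -> U (f t) ->
    exists d, 0 < d /\ forall s, u <= s <= v -> Rabs (s - t) < d -> U (f s).

Definition homotopy_on {X : Top} (u v : R) (H : R -> R -> X) : Prop :=
  forall s t (U : X -> Prop), u <= s <= v -> 0 <= t <= 1 -> is_open U -> U (H s t) ->
    exists d, 0 < d /\ forall s' t', u <= s' <= v -> 0 <= t' <= 1 ->
      Rabs (s' - s) < d -> Rabs (t' - t) < d -> U (H s' t').

Lemma path_homotopy_on {X : Top} (u v : R) (f : R -> X) :
  path_on u v f <-> homotopy_on u v (fun s _ => f s).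
Proof.
  split.
  - intros H s t U Hs _ HU Us. destruct (H s U Hs HU Us) as [d [Hd H']].
    exists d. auto.
  - intros H s U Hs HU Us. destruct (H s 0 U Hs ltac:(lra) HU Us) as [d [Hd H']].
    exists d. split; [exact Hd|]. intros s' Hs' Hd'. apply (H' s' 0); try lra.
    rewrite Rminus_diag, Rabs_R0. exact Hd.
Qed.

Lemma path_on_sub {X : Top} (u v u' v' : R) (f : R -> X) :
  u <= u' -> v' <= v -> path_on u v f -> path_on u' v' f.
Proof.
  intros Hu Hv H t U Ht HU Ut. destruct (H t U ltac:(lra) HU Ut) as [d [Hd H']].
  exists d. split; [exact Hd|]. intros s Hs. apply H'. lra.
Qed.

(** Pasting: on the seam [s = m] the smaller of the two radii serves both sides, and off the seam
    the radius is shrunk so as not to cross it. *)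
Lemma homotopy_on_glue {X : Top} (u m v : R) (H1 H2 : R -> R -> X) :
  u <= m <= v -> homotopy_on u m H1 -> homotopy_on m v H2 ->
  (forall t, 0 <= t <= 1 -> H1 m t = H2 m t) ->
  homotopy_on u v (fun s t => if Rle_dec s m then H1 s t else H2 s t).
Proof.
  intros Hm C1 C2 E s t U Hs Ht HU.
  assert (L : s <= m -> U (H1 s t) -> exists d, 0 < d /\ forall s' t', u <= s' <= m ->
     0 <= t' <= 1 -> Rabs (s' - s) < d -> Rabs (t' - t) < d -> U (H1 s' t')).
  { intros Hsm Us. apply C1; auto; lra. }
  assert (M : m <= s -> U (H2 s t) -> exists d, 0 < d /\ forall s' t', m <= s' <= v ->
     0 <= t' <= 1 -> Rabs (s' - s) < d -> Rabs (t' - t) < d -> U (H2 s' t')).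
  { intros Hsm Us. apply C2; auto; lra. }
  destruct (Rtotal_order s m) as [Hlt|[Heq|Hgt]].
  - destruct (Rle_dec s m) as [_|]; [|lra]. intros Us.
    destruct (L ltac:(lra) Us) as [d [Hd H]].
    exists (Rmin d (m - s)). split; [apply Rmin_pos; lra|].
    intros s' t' Hs' Ht' A1 A2.
    pose proof (Rmin_l d (m - s)). pose proof (Rmin_r d (m - s)).
    apply Rabs_def2 in A1 as A3.
    destruct (Rle_dec s' m); [apply H; lra | lra].
  - subst s. destruct (Rle_dec m m) as [_|]; [|lra]. intros Us.
    destruct (L ltac:(lra) Us) as [d1 [Hd1 G1]].
    rewrite E in Us by exact Ht. destruct (M ltac:(lra) Us) as [d2 [Hd2 G2]].
    exists (Rmin d1 d2). split; [apply Rmin_pos; lra|].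
    intros s' t' Hs' Ht' A1 A2.
    pose proof (Rmin_l d1 d2). pose proof (Rmin_r d1 d2).
    destruct (Rle_dec s' m); [apply G1; lra | apply G2; lra].
  - destruct (Rle_dec s m) as [|_]; [lra|]. intros Us.
    destruct (M ltac:(lra) Us) as [d [Hd H]].
    exists (Rmin d (s - m)). split; [apply Rmin_pos; lra|].
    intros s' t' Hs' Ht' A1 A2.
    pose proof (Rmin_l d (s - m)). pose proof (Rmin_r d (s - m)).
    apply Rabs_def2 in A1 as A3.
    destruct (Rle_dec s' m); [lra | apply H; lra].
Qed.

Lemma path_on_continuous {X : Top} (f : R -> X) :
  path_on 0 1 f -> @continuous Itop X (fun t => f (proj1_sig t)).
Proof.
  intros H U HU t Ut. destruct (H _ U (proj2_sig t) HU Ut) as [d [Hd H']].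
  exists d. split; [exact Hd|]. intros s. apply H', (proj2_sig s).
Qed.

Lemma I_ball_open (t : Icar) (d : R) :
  @is_open Itop (fun s => Rabs (proj1_sig s - proj1_sig t) < d).
Proof.
  intros s Hs. exists (d - Rabs (proj1_sig s - proj1_sig t)). split; [lra|].
  intros r Hr.
  replace (proj1_sig r - proj1_sig t)
    with ((proj1_sig r - proj1_sig s) + (proj1_sig s - proj1_sig t)) by ring.
  pose proof (Rabs_triang (proj1_sig r - proj1_sig s) (proj1_sig s - proj1_sig t)). lra.
Qed.

Lemma homotopy_on_continuous {X : Top} (H : R -> R -> X) :
  homotopy_on 0 1 H -> @continuous (prod_top Itop Itop) X
    (fun q => H (proj1_sig (fst q)) (proj1_sig (snd q))).
Proof.
  intros HH U HU. apply open_of_nbhds. intros [s t] Ust. simpl in Ust.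
  destruct (HH _ _ U (proj2_sig s) (proj2_sig t) HU Ust) as [d [Hd H']].
  exists (fun q => Rabs (proj1_sig (fst q) - proj1_sig s) < d /\
                   Rabs (proj1_sig (snd q) - proj1_sig t) < d).
  split; [|split].
  - apply go_basic. exists (fun r => Rabs (proj1_sig r - proj1_sig s) < d),
      (fun r => Rabs (proj1_sig r - proj1_sig t) < d).
    split; [apply I_ball_open|]. split; [apply I_ball_open | reflexivity].
  - simpl. rewrite !Rminus_diag, Rabs_R0. auto.
  - intros [s' t'] [A1 A2]. apply H'; auto; apply proj2_sig.
Qed.

(** * Neighbourhoods in the compact-open topology *)

(** The complements of closed balls around [t] cover [K]; the least radius in a finite subcover is a
    lower bound for the distance. *)
Lemma compact_I_separated (K : Itop -> Prop) (t : Icar) : compact K -> ~ K t ->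
  exists d, 0 < d /\ forall s : Icar, K s -> d <= Rabs (proj1_sig s - proj1_sig t).
Proof.
  intros HK Kt.
  set (F := fun W : Itop -> Prop => exists d, 0 < d /\
    W = (fun s : Icar => d < Rabs (proj1_sig s - proj1_sig t))).
  destruct (HK F) as [l [Hl1 Hl2]].
  - intros W [d [Hd ->]] s Hs. exists (Rabs (proj1_sig s - proj1_sig t) - d).
    split; [lra|]. intros r Hr.
    pose proof (Rabs_triang (proj1_sig s - proj1_sig r) (proj1_sig r - proj1_sig t)) as T.
    replace (proj1_sig s - proj1_sig r + (proj1_sig r - proj1_sig t))
      with (proj1_sig s - proj1_sig t) in T by ring.
    rewrite Rabs_minus_sym in Hr. lra.
  - intros s Ks.
    assert (Hp : 0 < Rabs (proj1_sig s - proj1_sig t)).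
    { apply Rabs_pos_lt. intros E. apply Kt. replace t with s; [exact Ks|].
      apply Icar_eq. lra. }
    eexists. split; [exists (Rabs (proj1_sig s - proj1_sig t) / 2); split;
      [lra | reflexivity] | simpl; lra].
  - assert (Hd : exists d, 0 < d /\ forall s : Icar, (exists W, In W l /\ W s) ->
      d <= Rabs (proj1_sig s - proj1_sig t)).
    { clear Hl2. induction l as [|W l IH].
      - exists 1. split; [lra|]. intros s [W [[] _]].
      - destruct IH as [d [Hd H]]; [intros; apply Hl1; right; assumption|].
        destruct (Hl1 W (or_introl eq_refl)) as [e [He ->]].
        exists (Rmin d e). split; [apply Rmin_pos; assumption|].
        pose proof (Rmin_l d e). pose proof (Rmin_r d e).
        intros s [W [[<-|HW] Ws]]; [lra|].
        enough (d <= Rabs (proj1_sig s - proj1_sig t)) by lra. eauto. }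
    destruct Hd as [d [Hd H]]. exists d. auto.
Qed.

(** Replaces an open set of loops by a condition [P] on the points of the graph, which holds on a
    box around each point of the graph of [g]. Such a condition can be checked piece by piece on a
    subdivision. *)
Lemma loop_top_nbhd {Y : Top} {y : Y} (O : loop_top Y y -> Prop) (g : loop Y y) :
  is_open O -> O g -> exists P : R -> Y -> Prop,
    (forall t : Icar, exists (U : Y -> Prop) d, is_open U /\ 0 < d /\ U (lpath g t) /\
      forall s q, Rabs (s - proj1_sig t) < d -> U q -> P s q) /\
    (forall h : loop Y y, (forall t, P (proj1_sig t) (lpath h t)) -> O h).
Proof.
  intros HO. induction HO as [O HO| |O1 O2 _ IH1 _ IH2|F _ IH].
  - destruct HO as [K [U [HK [HU ->]]]]. intros Og.
    exists (fun s q => forall t : Icar, proj1_sig t = s -> K t -> U q). split.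
    + intros t. destruct (classic (K t)) as [Kt|Kt].
      * exists U, 1. split; [exact HU|]. split; [lra|]. split; auto.
      (* Near a time outside [K] there are no times of [K], so [P] holds vacuously there. *)
      * destruct (compact_I_separated K t HK Kt) as [d [Hd H]].
        exists (fun _ => True), d. split; [apply open_full|]. split; [exact Hd|].
        split; [exact I|]. intros s q Hs _ r <- Kr. specialize (H r Kr). lra.
    + intros h Hh t Kt. apply (Hh t t); auto.
  - intros _. exists (fun _ _ => True). split; [|auto].
    intros t. exists (fun _ => True), 1. split; [apply open_full|]. split; [lra | auto].
  - intros [Og1 Og2]. destruct (IH1 Og1) as [P1 [L1 G1]]. destruct (IH2 Og2) as [P2 [L2 G2]].
    exists (fun s q => P1 s q /\ P2 s q). split.
    + intros t. destruct (L1 t) as [U1 [d1 [HU1 [Hd1 [Ug1 H1]]]]].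
      destruct (L2 t) as [U2 [d2 [HU2 [Hd2 [Ug2 H2]]]]].
      exists (fun q => U1 q /\ U2 q), (Rmin d1 d2).
      split; [apply open_inter; assumption|]. split; [apply Rmin_pos; assumption|].
      split; [auto|]. intros s q Hs [Q1 Q2].
      pose proof (Rmin_l d1 d2). pose proof (Rmin_r d1 d2).
      split; [apply H1 | apply H2]; auto; lra.
    + intros h Hh. split; [apply G1 | apply G2]; intros t; apply Hh.
  - intros [U [FU Ug]]. destruct (IH U FU Ug) as [P [L G]]. exists P. split; [exact L|].
    intros h Hh. exists U. auto.
Qed.

(** * Paths of [X] whose projections deform into prescribed sets *)

(** A path [f] from [x] to [y] together with a homotopy, rel endpoints, from its projection to a
    path whose graph lies in [P]. Only the final path is constrained by [P], so [f] itself may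
    project far away. *)
Definition seg {X Y : Top} (p : X -> Y) (P : R -> Y -> Prop) (u v : R) (x y : X) : Prop :=
  exists (f : R -> X) (H : R -> R -> Y),
    path_on u v f /\ f u = x /\ f v = y /\ homotopy_on u v H /\
    (forall s, u <= s <= v -> H s 0 = p (f s)) /\
    (forall t, 0 <= t <= 1 -> H u t = p x /\ H v t = p y) /\
    (forall s, u <= s <= v -> P s (H s 1)).

Lemma seg_weaken {X Y : Top} (p : X -> Y) (P Q : R -> Y -> Prop) (u v : R) (x y : X) :
  (forall s q, u <= s <= v -> P s q -> Q s q) -> seg p P u v x y -> seg p Q u v x y.
Proof.
  intros HPQ [f [H [C [Hu [Hv [D [H0 [He H1]]]]]]]].
  exists f, H. repeat (split; [assumption|]). auto.
Qed.

Lemma seg_concat {X Y : Top} (p : X -> Y) (P : R -> Y -> Prop) (u m v : R) (x z y : X) :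
  u <= m <= v -> seg p P u m x z -> seg p P m v z y -> seg p P u v x y.
Proof.
  intros Hm [f [H [C [Hu [Hv [D [H0 [He H1]]]]]]]]
    [f' [H' [C' [Hu' [Hv' [D' [H0' [He' H1']]]]]]]].
  exists (fun s => if Rle_dec s m then f s else f' s),
    (fun s t => if Rle_dec s m then H s t else H' s t).
  split.
  { apply path_homotopy_on.
    apply (homotopy_on_glue u m v (fun s _ => f s) (fun s _ => f' s));
      [lra | apply path_homotopy_on; assumption.. | congruence]. }
  split. { destruct (Rle_dec u m); [assumption | lra]. }
  split.
  { destruct (Rle_dec v m); [|assumption].
    assert (v = m) by lra. subst v. congruence. }
  split.
  { apply homotopy_on_glue; auto. intros t Ht.
    rewrite (proj2 (He t Ht)), (proj1 (He' t Ht)). reflexivity. }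
  split. { intros s Hs. destruct (Rle_dec s m); [apply H0 | apply H0']; lra. }
  split.
  { intros t Ht. split.
    - destruct (Rle_dec u m); [apply He, Ht | lra].
    - destruct (Rle_dec v m); [|apply He', Ht].
      assert (v = m) by lra. subst v. rewrite (proj2 (He t Ht)).
      rewrite <- (proj1 (He' t Ht)). apply He', Ht. }
  intros s Hs. destruct (Rle_dec s m); [apply H1 | apply H1']; lra.
Qed.

Lemma seg_of_path {X Y : Top} (p : X -> Y) (P : R -> Y -> Prop) (u v : R) (f : R -> X) :
  continuous p -> path_on u v f -> (forall s, u <= s <= v -> P s (p (f s))) ->
  seg p P u v (f u) (f v).
Proof.
  intros Hp C HP. exists f, (fun s _ => p (f s)).
  split; [exact C|]. split; [reflexivity|]. split; [reflexivity|].
  split; [|auto].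
  apply (path_homotopy_on u v (fun s => p (f s))).
  intros t U Ht HU. apply (C t (fun z => U (p z)) Ht). apply Hp, HU.
Qed.

Lemma seg_refl {X Y : Top} (p : X -> Y) (P : R -> Y -> Prop) (u v : R) (x : X) :
  continuous p -> (forall s, u <= s <= v -> P s (p x)) -> seg p P u v x x.
Proof.
  intros Hp HP. apply (seg_of_path p P u v (fun _ => x)); auto.
  intros t U _ _ Ux. exists 1. split; [lra | auto].
Qed.

(** Quantifying over all intervals frees the relation from any parametrization, which makes it
    transitive. *)
Definition link {X Y : Top} (p : X -> Y) (U : Y -> Prop) (x y : X) : Prop :=
  forall u v, u < v -> seg p (fun _ => U) u v x y.

Lemma link_trans {X Y : Top} (p : X -> Y) (U : Y -> Prop) (x y z : X) :
  link p U x y -> link p U y z -> link p U x z.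
Proof.
  intros H1 H2 u v Huv. apply seg_concat with ((u + v) / 2) y;
    [lra | apply H1; lra | apply H2; lra].
Qed.

Lemma path_on_affine {X : Top} (g : Itop -> X) (u v : R) : u < v -> continuous g ->
  path_on u v (fun s => g (clamp ((s - u) / (v - u)))).
Proof.
  intros Huv Hg t U Ht HU Ut. destruct (clamp_nbhd g _ U Hg HU Ut) as [d [Hd H]].
  exists (d * (v - u)). split; [apply Rmult_lt_0_compat; lra|].
  intros s _ Hs. apply H.
  replace ((s - u) / (v - u) - (t - u) / (v - u)) with ((s - t) / (v - u)) by (field; lra).
  unfold Rdiv. rewrite Rabs_mult, Rabs_inv, (Rabs_pos_eq (v - u)) by lra.
  apply Rmult_lt_reg_r with (v - u); [lra|].
  rewrite Rmult_assoc, Rinv_l, Rmult_1_r by lra. exact Hs.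
Qed.

Lemma clamp_affine_ends (u v : R) : u < v ->
  clamp ((u - u) / (v - u)) = I0 /\ clamp ((v - u) / (v - u)) = I1.
Proof.
  intros Huv. split; apply Icar_eq; rewrite Rdiv_diag || rewrite Rminus_diag, Rdiv_0_l;
    try lra; rewrite clamp_in by lra; reflexivity.
Qed.

Lemma link_of_path {X Y : Top} (p : X -> Y) (U : Y -> Prop) (g : Itop -> X) :
  continuous p -> continuous g -> (forall t, U (p (g t))) -> link p U (g I0) (g I1).
Proof.
  intros Hp Hg HU u v Huv. destruct (clamp_affine_ends u v Huv) as [E0 E1].
  rewrite <- E0, <- E1.
  apply (seg_of_path p (fun _ => U) u v (fun s => g (clamp ((s - u) / (v - u)))));
    auto using path_on_affine.
Qed.

(* If every point of the projected path specializes to [star], pushing the interior of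
   the path to [star] at all positive times is continuous. *)
Lemma link_dense_point {X Y : Top} (p : X -> Y) (U : Y -> Prop) (g : Itop -> X) (star : Y) :
  continuous p -> continuous g ->
  (forall t (V : Y -> Prop), is_open V -> V (p (g t)) -> V star) ->
  U star -> U (p (g I0)) -> U (p (g I1)) -> link p U (g I0) (g I1).
Proof.
  intros Hp Hg Hstar Ustar U0 U1 u v Huv.
  destruct (clamp_affine_ends u v Huv) as [E0 E1].
  pose proof (path_on_affine g u v Huv Hg) as C. rewrite <- E0, <- E1 in *.
  set (f := fun s => g (clamp ((s - u) / (v - u)))) in *.
  change (seg p (fun _ => U) u v (f u) (f v)).
  change (U (p (f u))) in U0. change (U (p (f v))) in U1.
  (* On the two vertical sides and the bottom of the square the homotopy follows [p (f s)];
     everywhere else it equals [star]. *)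
  set (b := fun s t : R => s = u \/ s = v \/ t = 0).
  exists f, (fun s t => if excluded_middle_informative (b s t) then p (f s) else star).
  split; [exact C|]. split; [reflexivity|]. split; [reflexivity|]. split; [|split; [|split]].
  - intros s t V Hs Ht HV. destruct (excluded_middle_informative (b s t)) as [B|B]; intros Vs.
    + destruct (C s (fun z => V (p z)) Hs (Hp V HV) Vs) as [d [Hd H]].
      exists d. split; [exact Hd|]. intros s' t' Hs' Ht' A1 A2.
      (* A nearby point off [b] has value [star], which lies in [V] because [V] contains
         [p (f s)]. *)
      destruct (excluded_middle_informative (b s' t')); [auto|].
      exact (Hstar _ V HV Vs).
    + assert (s <> u /\ s <> v /\ t <> 0) as [N1 [N2 N3]] by (unfold b in B; tauto).
      exists (Rmin t (Rmin (s - u) (v - s))).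
      split; [apply Rmin_pos; [lra | apply Rmin_pos; lra]|].
      intros s' t' Hs' Ht' A1 A2.
      pose proof (Rmin_l t (Rmin (s - u) (v - s))).
      pose proof (Rmin_r t (Rmin (s - u) (v - s))).
      pose proof (Rmin_l (s - u) (v - s)). pose proof (Rmin_r (s - u) (v - s)).
      apply Rabs_def2 in A1. apply Rabs_def2 in A2.
      destruct (excluded_middle_informative (b s' t')) as [[B'|[B'|B']]|]; [lra..|exact Vs].
  - intros s _. destruct (excluded_middle_informative (b s 0)) as [|B]; [reflexivity|].
    exfalso. unfold b in B. tauto.
  - intros t _. split.
    + destruct (excluded_middle_informative (b u t)) as [|B]; [reflexivity|].
      exfalso. unfold b in B. tauto.
    + destruct (excluded_middle_informative (b v t)) as [|B]; [reflexivity|].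
      exfalso. unfold b in B. tauto.
  - intros s _. destruct (excluded_middle_informative (b s 1)) as [[->|[->|B]]|]; auto. lra.
Qed.

(** * Fibres and saturated sets of the collapse *)

Lemma collapse_surj (X : Top) (n : nat) (A : nat -> X -> Prop) (q : collapse_top X n A) :
  exists x, collapse_proj X n A x = q.
Proof. exists (qrep q). apply qproj_qrep. Qed.

Lemma collapse_continuous (X : Top) (n : nat) (A : nat -> X -> Prop) :
  continuous (collapse_proj X n A).
Proof. apply qproj_continuous. Qed.

Lemma collapse_eq (X : Top) (n : nat) (A : nat -> X -> Prop) (i : nat) (x y : X) :
  (i < n)%nat -> A i x -> A i y -> collapse_proj X n A x = collapse_proj X n A y.
Proof. intros Hi Hx Hy. apply qproj_eq, rst_step. exists i. auto. Qed.

Definition saturated {X : Top} (n : nat) (A : nat -> X -> Prop) (V : X -> Prop) : Prop :=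
  forall i x y, (i < n)%nat -> A i x -> A i y -> V x -> V y.

Lemma saturated_eq {X : Top} (n : nat) (A : nat -> X -> Prop) (V : X -> Prop) (x y : X) :
  saturated n A V -> collapse_proj X n A x = collapse_proj X n A y -> V x -> V y.
Proof.
  intros HV E. apply qproj_eq in E. enough (V x <-> V y) by tauto.
  induction E as [x y [i [Hi [Ax Ay]]]| | | ]; [|tauto..].
  split; apply (HV i); assumption.
Qed.

Lemma saturated_image_open {X : Top} (n : nat) (A : nat -> X -> Prop) (V : X -> Prop) :
  saturated n A V -> is_open V ->
  is_open (fun q => exists x, V x /\ collapse_proj X n A x = q).
Proof.
  intros HV HO. change (is_open (fun z : X =>
    exists x, V x /\ collapse_proj X n A x = collapse_proj X n A z)).
  replace (fun z : X => exists x, V x /\ collapse_proj X n A x = collapse_proj X n A z)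
    with V; [exact HO|].
  apply set_ext. intros z. split; [eauto|].
  intros [x [Vx E]]. exact (saturated_eq n A V x z HV E Vx).
Qed.

(** The point [y] together with all the sets [A i] forms a saturated set. *)
Lemma collapse_eq_cases (X : Top) (n : nat) (A : nat -> X -> Prop) (x y : X) :
  collapse_proj X n A x = collapse_proj X n A y -> x = y \/ exists i, (i < n)%nat /\ A i x.
Proof.
  intros E. symmetry in E.
  apply (saturated_eq n A (fun z => z = y \/ exists i, (i < n)%nat /\ A i z) y x); auto.
  intros i z w Hi Az Aw _. eauto.
Qed.

Lemma collapse_eq_in (X : Top) (n : nat) (A : nat -> X -> Prop) (i : nat) (x y : X) :
  collapse_proj X n A x = collapse_proj X n A y -> (i < n)%nat -> A i x ->
  exists j, (j < n)%nat /\ A j y.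
Proof.
  intros E Hi Ax. symmetry in E.
  destruct (collapse_eq_cases X n A y x E) as [->|H]; eauto.
Qed.

(** An open set containing the image of a point of the closure of [A i] contains the image of all of
    [A i]. Hence [p w] can serve as the dense point for a path inside that closure. *)
Lemma link_closure (X : Top) (n : nat) (A : nat -> X -> Prop)
  (U : collapse_top X n A -> Prop) (i : nat) (x y w : X) :
  (i < n)%nat -> path_connected_set (closure (A i)) ->
  closure (A i) x -> closure (A i) y -> A i w ->
  U (collapse_proj X n A x) -> U (collapse_proj X n A y) -> U (collapse_proj X n A w) ->
  link (collapse_proj X n A) U x y.
Proof.
  intros Hi Hpc Cx Cy Aw Ux Uy Uw. destruct (Hpc x y Cx Cy) as [g [Hg [<- [<- Hcl]]]].
  apply (link_dense_point _ U g (collapse_proj X n A w)); auto using collapse_continuous.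
  intros t V HV Vt.
  destruct (closure_meets (A i) (fun z => V (collapse_proj X n A z)) (g t) (Hcl t))
    as [z [Az Vz]]; [apply collapse_continuous, HV | exact Vt |].
  rewrite (collapse_eq X n A i w z); auto.
Qed.

(** The sets [A i] may overlap, so a fibre can be a chain of several of them. The points of the
    preimage of [U] linked to [x] form a saturated set, which therefore contains the whole fibre. *)
Lemma link_fiber (X : Top) (n : nat) (A : nat -> X -> Prop)
  (U : collapse_top X n A -> Prop) (x y : X) :
  (forall i, (i < n)%nat -> path_connected_set (closure (A i))) ->
  U (collapse_proj X n A x) -> collapse_proj X n A x = collapse_proj X n A y ->
  link (collapse_proj X n A) U x y.
Proof.
  intros Hpc Ux E.
  apply (saturated_eq n A (fun z => U (collapse_proj X n A z) /\
    link (collapse_proj X n A) U x z) x y); [|exact E|].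
  - intros i z w Hi Az Aw [Uz Lz].
    pose proof Uz as Uw. rewrite (collapse_eq X n A i z w) in Uw by assumption.
    split; [exact Uw|]. apply link_trans with z; [exact Lz|].
    apply (link_closure X n A U i z w z); auto using closure_subset.
  - split; [exact Ux|]. intros u v _. apply seg_refl; auto using collapse_continuous.
Qed.

(* The target form shared by both cases of condition (star): near [t], [g] can be replaced
   by the projection of a path of [X] with prescribed endpoints. *)
Definition locally_segmented (X : Top) (n : nat) (A : nat -> X -> Prop) : Prop :=
  forall (g : R -> collapse_top X n A) (t : R) (U : collapse_top X n A -> Prop),
    path_on 0 1 g -> 0 <= t <= 1 -> is_open U -> U (g t) ->
    exists d, 0 < d /\ forall u v x y, 0 <= u -> u < v -> v <= 1 ->
      Rabs (u - t) < d -> Rabs (v - t) < d ->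
      collapse_proj X n A x = g u -> collapse_proj X n A y = g v ->
      seg (collapse_proj X n A) (fun _ => U) u v x y.

(** * Case (ii): locally path connected spaces with disjoint closures *)

(** Saturation makes the image of [V] open, so [g] stays in it near [t]; it also puts every lift of
    a point of that image into [V], whichever endpoints are prescribed. *)
Lemma locally_segmented_of_links (X : Top) (n : nat) (A : nat -> X -> Prop) :
  (forall (x : X) (U : collapse_top X n A -> Prop), is_open U -> U (collapse_proj X n A x) ->
    exists V, is_open V /\ saturated n A V /\ V x /\
      forall y z, V y -> V z -> link (collapse_proj X n A) U y z) ->
  locally_segmented X n A.
Proof.
  intros H g t U Hg Ht HU Ut. destruct (collapse_surj X n A (g t)) as [x Ex].
  rewrite <- Ex in Ut. destruct (H x U HU Ut) as [V [HV [SV [Vx L]]]].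
  destruct (Hg t _ Ht (saturated_image_open n A V SV HV)) as [d [Hd G]]; [eauto|].
  exists d. split; [exact Hd|]. intros u v y z Hu Huv Hv Du Dv Ey Ez.
  destruct (G u ltac:(lra) Du) as [y' [Vy' Ey']].
  destruct (G v ltac:(lra) Dv) as [z' [Vz' Ez']].
  apply L; [|  |exact Huv].
  - apply (saturated_eq n A V y'); auto. congruence.
  - apply (saturated_eq n A V z'); auto. congruence.
Qed.

Lemma locally_segmented_lpc (X : Top) (n : nat) (A : nat -> X -> Prop) :
  locally_path_connected X ->
  (forall i, (i < n)%nat -> path_connected_set (closure (A i))) ->
  (forall i j, (i < n)%nat -> (j < n)%nat -> i <> j ->
      forall x, ~ (closure (A i) x /\ closure (A j) x)) ->
  locally_segmented X n A.
Proof.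
  intros Hl Hpc Hd. apply locally_segmented_of_links. intros x U HU Ux.
  set (p := collapse_proj X n A) in *.
  assert (HO : is_open (fun z => U (p z))) by (apply collapse_continuous, HU).
  assert (Lpc : forall (W : X -> Prop), path_connected_set W ->
    (forall z, W z -> U (p z)) -> forall y z, W y -> W z -> link p U y z).
  { intros W HW HWU y z Wy Wz. destruct (HW y z Wy Wz) as [g [Hg [<- [<- Hin]]]].
    apply link_of_path; auto. apply collapse_continuous. }
  destruct (classic (exists i, (i < n)%nat /\ closure (A i) x)) as [[i [Hi Cx]]|Hn].
  - destruct (closure_meets (A i) _ x Cx HO Ux) as [w [Aw Uw]].
    (* Avoiding the closures of the other sets ensures that only [A i] matters for saturation. *)
    set (O := fun z => U (p z) /\
      forall j, (j < n)%nat -> (j <> i) -> ~ closure (A j) z).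
    assert (OO : is_open O) by (apply open_inter; [exact HO | apply open_avoid_closures]).
    (* The neighbourhood is the union of these pieces; each meets [A i], so its points can travel to
       [A i] within the piece. *)
    set (piece := fun W : X -> Prop => is_open W /\ path_connected_set W /\
      (forall z, W z -> O z) /\ exists c, A i c /\ W c).
    assert (HA : forall c, closure (A i) c -> U (p c) -> exists W, piece W /\ W c).
    { intros c Cc Uc. destruct (Hl c O OO) as [W [W1 [W2 [W3 W4]]]].
      - split; [exact Uc|]. intros j Hj Hji Cj. apply (Hd i j Hi Hj) with c; auto.
      - exists W. split; [|exact W2]. split; [exact W1|]. split; [exact W4|].
        split; [exact W3|]. destruct (closure_meets (A i) W c Cc W1 W2) as [c' ?]. eauto. }
    exists (fun z => exists W, piece W /\ W z). split; [|split; [|split]].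
    + apply open_union. intros W [W1 _]. exact W1.
    + intros j y z Hj Ay Az [W [[_ [_ [W3 _]]] Wy]].
      destruct (Nat.eq_dec j i) as [->|Hji].
      * apply HA; [apply closure_subset, Az|]. unfold p.
        rewrite (collapse_eq X n A i z w); auto.
      * exfalso. apply (proj2 (W3 y Wy) j Hj Hji). apply closure_subset, Ay.
    + apply HA; auto.
    + intros y z [W [[W1 [W2 [W3 [c [Ac Wc]]]]] Wy]] [W' [[W1' [W2' [W3' [c' [Ac' Wc']]]]] Wz]].
      (* The route goes from [y] to [c] in one piece, from [c] to [c'] inside the closure of [A i],
         and from [c'] to [z] in the other piece. *)
      apply link_trans with c; [apply (Lpc W); auto; apply W3|].
      apply link_trans with c'; [|apply (Lpc W'); auto; apply W3'].
      apply (link_closure X n A U i c c' c); auto using closure_subset;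
        [apply W3, Wc | apply W3', Wc' | apply W3, Wc].
  - destruct (Hl x (fun z => U (p z) /\ forall j, (j < n)%nat -> True -> ~ closure (A j) z))
      as [W [W1 [W2 [W3 W4]]]].
    + apply open_inter; [exact HO | apply open_avoid_closures].
    + split; [exact Ux|]. intros j Hj _ Cj. apply Hn. eauto.
    + exists W. split; [exact W1|]. split; [|split; [exact W2|]].
      * intros j y z Hj Ay _ Wy. exfalso.
        apply (proj2 (W3 y Wy) j Hj I). apply closure_subset, Ay.
      * apply Lpc; [exact W4|]. apply W3.
Qed.

(** * Case (i): open sets [A i] *)

(** A point over the image of [V] lies in [V] or in some [A i]; in the second case the open set
    [A i] has the same single image. *)
Lemma open_collapse_image (X : Top) (n : nat) (A : nat -> X -> Prop) (V : X -> Prop) :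
  (forall i, (i < n)%nat -> is_open (A i)) -> is_open V ->
  is_open (fun q => exists x, V x /\ collapse_proj X n A x = q).
Proof.
  intros Hop HV. change (is_open (fun z : X =>
    exists x, V x /\ collapse_proj X n A x = collapse_proj X n A z)).
  apply open_of_nbhds. intros z [x [Vx E]]. symmetry in E.
  destruct (collapse_eq_cases X n A z x E) as [->|[i [Hi Az]]].
  - exists V. split; [exact HV|]. split; [exact Vx|]. eauto.
  - exists (A i). split; [auto|]. split; [exact Az|]. intros y Ay. exists x.
    split; [exact Vx|]. rewrite <- E. apply (collapse_eq X n A i); auto.
Qed.

(** The fibre of [w] is covered by the finitely many [A j] that meet it, and the closure of a finite
    union is the union of the closures. *)
Lemma in_closure_of_fiber (X : Top) (n : nat) (A : nat -> X -> Prop) (i : nat) (w x : X) :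
  (i < n)%nat -> A i w ->
  (forall V, is_open V -> V x ->
     exists z, V z /\ collapse_proj X n A z = collapse_proj X n A w) ->
  exists j z, (j < n)%nat /\ A j z /\ closure (A j) x /\
    collapse_proj X n A z = collapse_proj X n A w.
Proof.
  intros Hi Aw H. apply NNPP. intros Hn.
  set (J := fun j => exists z, A j z /\ collapse_proj X n A z = collapse_proj X n A w).
  destruct (H _ (open_avoid_closures A n J)) as [z [Vz Ez]].
  - intros j Hj [z [Az Ez]] Cx. apply Hn. exists j, z. auto.
  - destruct (collapse_eq_in X n A i w z (eq_sym Ez) Hi Aw) as [j [Hj Az]].
    apply (Vz j Hj); [exists z; auto | apply closure_subset, Az].
Qed.

Lemma exists_sup (E : R -> Prop) (u v : R) :
  (forall s, E s -> u <= s <= v) -> (exists s, E s) ->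
  exists m, u <= m <= v /\ (forall s, E s -> s <= m) /\
    forall d, 0 < d -> exists s, E s /\ m - d < s.
Proof.
  intros HE [s0 E0]. destruct (completeness E) as [m [Hub Hl]].
  - exists v. intros s Es. apply HE, Es.
  - eauto.
  - exists m. split; [|split; [exact Hub|]].
    + split; [apply Rle_trans with s0; [apply HE, E0 | apply Hub, E0]|].
      apply Hl. intros s Es. apply HE, Es.
    + intros d Hd. apply NNPP. intros Hn.
      assert (m <= m - d); [|lra]. apply Hl. intros s Es.
      destruct (Rle_dec s (m - d)); [assumption|]. exfalso. apply Hn. exists s. split; [exact Es | lra].
Qed.

Lemma exists_inf (E : R -> Prop) (u v : R) :
  (forall s, E s -> u <= s <= v) -> (exists s, E s) ->
  exists m, u <= m <= v /\ (forall s, E s -> m <= s) /\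
    forall d, 0 < d -> exists s, E s /\ s < m + d.
Proof.
  intros HE [s0 E0].
  destruct (exists_sup (fun s => E (- s)) (- v) (- u)) as [m [Hm [Hub Hs]]].
  - intros s Es. specialize (HE _ Es). lra.
  - exists (- s0). rewrite Ropp_involutive. exact E0.
  - exists (- m). split; [lra|]. split.
    + intros s Es. specialize (Hub (- s)). rewrite Ropp_involutive in Hub.
      specialize (Hub Es). lra.
    + intros d Hd. destruct (Hs d Hd) as [s [Es Hlt]]. exists (- s). split; [exact Es | lra].
Qed.

(* Off the open points [p (A i)] the open map [p] is injective, so [g] lifts. *)
Lemma seg_lift (X : Top) (n : nat) (A : nat -> X -> Prop) (g : R -> collapse_top X n A)
  (P : R -> collapse_top X n A -> Prop) (u v : R) (x y : X) :
  (forall i, (i < n)%nat -> is_open (A i)) ->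
  path_on u v g -> (forall s, u <= s <= v -> P s (g s)) ->
  (forall s i w, u <= s <= v -> (i < n)%nat -> A i w -> collapse_proj X n A w <> g s) ->
  collapse_proj X n A x = g u -> collapse_proj X n A y = g v -> u <= v ->
  seg (collapse_proj X n A) P u v x y.
Proof.
  intros Hop Hg HP Hfree Ex Ey Huv. set (p := collapse_proj X n A) in *.
  assert (Hinj : forall s z z', u <= s <= v -> p z = g s -> p z' = g s -> z = z').
  { intros s z z' Hs Ez Ez'.
    destruct (collapse_eq_cases X n A z z') as [E|[i [Hi Az]]]; [unfold p in *; congruence|exact E|].
    exfalso. apply (Hfree s i z); auto. }
  set (f := fun s => qrep (g s)).
  assert (Ef : forall s, p (f s) = g s) by (intros s; apply qproj_qrep).
  replace x with (f u) by (apply (Hinj u); auto; lra).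
  replace y with (f v) by (apply (Hinj v); auto; lra).
  apply seg_of_path.
  - apply collapse_continuous.
  - intros t V Ht HV Vt.
    (* Openness of [p] provides a point of [V] over [g s], and injectivity identifies it with
       [f s]. *)
    destruct (Hg t _ Ht (open_collapse_image X n A V Hop HV)) as [d [Hd G]].
    + exists (f t). auto.
    + exists d. split; [exact Hd|]. intros s Hs Ds. destruct (G s Hs Ds) as [z [Vz Ez]].
      replace (f s) with z; [exact Vz|]. apply (Hinj s); auto.
  - intros s Hs. rewrite Ef. auto.
Qed.

(* Induction on the number [k] of open points [p (A i)] met by [g]: between the first and
   the last visit of the point [p (A k)], [g] is replaced by the constant path there. *)
Lemma seg_open (X : Top) (n : nat) (A : nat -> X -> Prop) (g : R -> collapse_top X n A)
  (U : collapse_top X n A -> Prop) (k : nat) :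
  (forall i, (i < n)%nat -> is_open (A i) /\ path_connected_set (closure (A i))) ->
  (k <= n)%nat -> forall (u v : R) (x y : X),
  path_on u v g -> (forall s, u <= s <= v -> U (g s)) ->
  (forall s i w, u <= s <= v -> (i < n)%nat -> A i w -> collapse_proj X n A w = g s ->
     exists j z, (j < k)%nat /\ A j z /\ collapse_proj X n A z = g s) ->
  collapse_proj X n A x = g u -> collapse_proj X n A y = g v -> u < v ->
  seg (collapse_proj X n A) (fun _ => U) u v x y.
Proof.
  intros HA. assert (Hop : forall i, (i < n)%nat -> is_open (A i)) by apply HA.
  assert (Hpc : forall i, (i < n)%nat -> path_connected_set (closure (A i))) by apply HA.
  set (p := collapse_proj X n A).
  assert (Hp : continuous p) by apply collapse_continuous.
  induction k as [|k IH]; intros Hk u v x y Hg HU Htype Ex Ey Huv.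
  { apply (seg_lift X n A g); auto; [|lra].
    intros s i w Hs Hi Aw E. destruct (Htype s i w Hs Hi Aw E) as [j [z [Hj _]]]. lia. }
  specialize (IH ltac:(lia)).
  set (visit := fun s => u <= s <= v /\ exists w, A k w /\ p w = g s).
  assert (Htype' : forall a b, u <= a -> b <= v -> (forall s, a <= s <= b -> ~ visit s) ->
    forall s i w, a <= s <= b -> (i < n)%nat -> A i w -> p w = g s ->
    exists j z, (j < k)%nat /\ A j z /\ p z = g s).
  { intros a b Ha Hb Hnv s i w Hs Hi Aw E.
    destruct (Htype s i w ltac:(lra) Hi Aw E) as [j [z [Hj [Az Ez]]]].
    exists j, z. split; [|auto]. destruct (Nat.eq_dec j k) as [->|]; [|lia].
    exfalso. apply (Hnv s Hs). split; [lra|]. eauto. }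
  assert (Hvopen : forall s, visit s -> exists d, 0 < d /\
    forall s', u <= s' <= v -> Rabs (s' - s) < d -> visit s').
  { intros s [Hs [w [Aw E]]].
    destruct (Hg s _ Hs (open_collapse_image X n A (A k) Hop (Hop k ltac:(lia))))
      as [d [Hd G]]; [eauto|].
    exists d. split; [exact Hd|]. intros s' Hs' Ds. split; auto. }
  destruct (classic (exists s, visit s)) as [Hv|Hnv].
  2: { apply IH; auto. apply Htype'; try lra. intros s Hs Vs. apply Hnv. eauto. }
  assert (Hrange : forall s, visit s -> u <= s <= v) by (intros s Vs; apply Vs).
  (* The visits are relatively open, so the infimum is a visit only if it equals [u], and the
     supremum only if it equals [v]. *)
  destruct (exists_inf visit u v Hrange Hv) as [m1 [Hm1 [Hlb Hinf]]].
  destruct (exists_sup visit u v Hrange Hv) as [m2 [Hm2 [Hub Hsup]]].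
  destruct Hv as [s0 Vs0]. destruct (proj2 Vs0) as [w [Aw Ew]].
  assert (Uw : U (p w)) by (rewrite Ew; apply HU, Vs0).
  (* Relative openness yields a second visit on one side of [s0]. *)
  assert (Hm : m1 < m2).
  { destruct (Hvopen s0 Vs0) as [d [Hd G]]. destruct (Hrange s0 Vs0) as [Hs1 Hs2].
    destruct (Rlt_dec s0 v) as [Hlt|Hge].
    - set (s := Rmin v (s0 + d / 2)).
      assert (Hs : s0 < s <= v /\ s <= s0 + d / 2).
      { unfold s. pose proof (Rmin_l v (s0 + d/2)). pose proof (Rmin_r v (s0 + d/2)).
        repeat split; auto. apply Rmin_glb_lt; lra. }
      assert (visit s) by (apply G; [lra | rewrite Rabs_pos_eq; lra]).
      pose proof (Hlb s0 Vs0). pose proof (Hub s H). lra.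
    - set (s := Rmax u (s0 - d / 2)).
      assert (Hs : u <= s < s0 /\ s0 - d / 2 <= s).
      { unfold s. pose proof (Rmax_l u (s0 - d/2)). pose proof (Rmax_r u (s0 - d/2)).
        repeat split; auto. apply Rmax_lub_lt; lra. }
      assert (visit s) by (apply G; [lra | rewrite Rabs_left; lra]).
      pose proof (Hlb s H). pose proof (Hub s0 Vs0). lra. }
  (* Either [m1] is [u] and a constant path suffices, or there is no visit up to and including [m1]
     and the induction hypothesis applies. *)
  assert (Hleft : exists x1, p x1 = g m1 /\ seg p (fun _ => U) u m1 x x1).
  { destruct (Req_dec u m1) as [<-|Hne].
    - exists x. split; [exact Ex|]. apply seg_refl; auto.
      intros _ _. rewrite Ex. apply HU. lra.
    - destruct (collapse_surj X n A (g m1)) as [x1 E1]. exists x1. split; [exact E1|].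
      apply IH; auto.
      + apply path_on_sub with u v; auto; lra.
      + intros s Hs. apply HU. lra.
      + apply Htype'; try lra. intros s Hs Vs.
        assert (s = m1) by (pose proof (Hlb s Vs); lra). subst s.
        destruct (Hvopen m1 Vs) as [d [Hd G]].
        pose proof (Rmax_l u (m1 - d / 2)). pose proof (Rmax_r u (m1 - d / 2)).
        assert (Rmax u (m1 - d / 2) < m1) by (apply Rmax_lub_lt; lra).
        assert (Vs' : visit (Rmax u (m1 - d / 2))).
        { apply G; [lra|]. rewrite Rabs_left; lra. }
        pose proof (Hlb _ Vs'). lra.
      + lra. }
  assert (Hright : exists x2, p x2 = g m2 /\ seg p (fun _ => U) m2 v x2 y).
  { destruct (Req_dec v m2) as [<-|Hne].
    - exists y. split; [exact Ey|]. apply seg_refl; auto.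
      intros _ _. rewrite Ey. apply HU. lra.
    - destruct (collapse_surj X n A (g m2)) as [x2 E2]. exists x2. split; [exact E2|].
      apply IH; auto.
      + apply path_on_sub with u v; auto; lra.
      + intros s Hs. apply HU. lra.
      + apply Htype'; try lra. intros s Hs Vs.
        assert (s = m2) by (pose proof (Hub s Vs); lra). subst s.
        destruct (Hvopen m2 Vs) as [d [Hd G]].
        pose proof (Rmin_l v (m2 + d / 2)). pose proof (Rmin_r v (m2 + d / 2)).
        assert (m2 < Rmin v (m2 + d / 2)) by (apply Rmin_glb_lt; lra).
        assert (Vs' : visit (Rmin v (m2 + d / 2))).
        { apply G; [lra|]. rewrite Rabs_pos_eq; lra. }
        pose proof (Hub _ Vs'). lra.
      + lra. }
  (* A lift [z] of a limit of visits adheres to the fibre of [w], since [p] is open; hence it lies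
     in the closure of some [A j] with the same image. *)
  assert (Hadh : forall m z, u <= m <= v -> p z = g m ->
    (forall d, 0 < d -> exists s, visit s /\ Rabs (s - m) < d) ->
    exists c, p c = p w /\ link p U z c /\ link p U c z).
  { intros m z Hmr Ez Hnear.
    destruct (in_closure_of_fiber X n A k w z ltac:(lia) Aw) as [j [c [Hj [Ac [Cz Ec]]]]].
    - intros V HV Vz.
      destruct (Hg m _ Hmr (open_collapse_image X n A V Hop HV)) as [d [Hd G]]; [eauto|].
      destruct (Hnear d Hd) as [s [[Hs [w' [Aw' Ew']]] Ds]].
      destruct (G s Hs Ds) as [z' [Vz' Ez']]. exists z'. split; [exact Vz'|].
      rewrite Ez', <- Ew'. apply (collapse_eq X n A k); auto.
    - exists c. split; [exact Ec|].
      assert (Uc : U (p c)) by (unfold p in *; rewrite Ec; exact Uw).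
      assert (Uz : U (p z)) by (rewrite Ez; auto).
      split; apply (link_closure X n A U j) with c; auto using closure_subset. }
  destruct Hleft as [x1 [E1 S1]]. destruct Hright as [x2 [E2 S2]].
  destruct (Hadh m1 x1) as [c1 [Ec1 [L1 _]]]; auto.
  { intros d Hd. destruct (Hinf d Hd) as [s [Vs Hs]]. exists s. split; [exact Vs|].
    pose proof (Hlb s Vs). rewrite Rabs_pos_eq; lra. }
  destruct (Hadh m2 x2) as [c2 [Ec2 [_ L2]]]; auto.
  { intros d Hd. destruct (Hsup d Hd) as [s [Vs Hs]]. exists s. split; [exact Vs|].
    pose proof (Hub s Vs). rewrite Rabs_left1; lra. }
  (* The points [c1] and [c2] lie in one fibre, so [x1] and [x2] are joined through them, whatever
     [g] does between [m1] and [m2]. *)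
  assert (L : link p U x1 x2).
  { apply link_trans with c1; [exact L1|]. apply link_trans with c2; [|exact L2].
    apply link_fiber; auto; unfold p in *; [rewrite Ec1; exact Uw | congruence]. }
  apply seg_concat with m1 x1; [lra | exact S1|].
  apply seg_concat with m2 x2; [lra | apply L; lra | exact S2].
Qed.

Lemma locally_segmented_open (X : Top) (n : nat) (A : nat -> X -> Prop) :
  (forall i, (i < n)%nat -> is_open (A i) /\ path_connected_set (closure (A i))) ->
  locally_segmented X n A.
Proof.
  intros HA g t U Hg Ht HU Ut. destruct (Hg t U Ht HU Ut) as [d [Hd G]].
  exists d. split; [exact Hd|]. intros u v x y Hu Huv Hv Du Dv Ex Ey.
  apply (seg_open X n A g U n HA (le_n n)); auto.
  - apply path_on_sub with 0 1; auto.
  - intros s Hs. apply G; [lra|]. apply Rabs_def2 in Du. apply Rabs_def2 in Dv.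
    apply Rabs_def1; lra.
  - intros s i w _ Hi Aw E. exists i, w. auto.
Qed.

(** * From local to global segments, density of the image, and the conclusion *)

Lemma locally_segmented_star (X : Top) (n : nat) (A : nat -> X -> Prop) :
  condition_star X n A -> locally_segmented X n A.
Proof.
  intros [[_ HA]|[_ [Hl [_ [HA Hd]]]]].
  - apply locally_segmented_open, HA.
  - apply locally_segmented_lpc; auto. intros i Hi. apply HA, Hi.
Qed.

(** A supremum argument takes the place of a subdivision: the times reachable from [a] by a segment
    extend past any supremum below 1. *)
Lemma seg_global (X : Top) (n : nat) (A : nat -> X -> Prop) (a b : X)
  (g : R -> collapse_top X n A) (P : R -> collapse_top X n A -> Prop) :
  locally_segmented X n A -> path_on 0 1 g ->
  collapse_proj X n A a = g 0 -> collapse_proj X n A b = g 1 ->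
  (forall t, 0 <= t <= 1 -> exists U d, is_open U /\ 0 < d /\ U (g t) /\
     forall s q, Rabs (s - t) < d -> U q -> P s q) ->
  seg (collapse_proj X n A) P 0 1 a b.
Proof.
  intros HL Hg Ea Eb HP. set (p := collapse_proj X n A) in *.
  assert (Hloc : forall t, 0 <= t <= 1 -> exists d, 0 < d /\
    forall u v x y, 0 <= u -> u < v -> v <= 1 -> Rabs (u - t) < d -> Rabs (v - t) < d ->
      p x = g u -> p y = g v -> seg p P u v x y).
  { intros t Ht. destruct (HP t Ht) as [U [d [HU [Hd [Ut HUP]]]]].
    destruct (HL g t U Hg Ht HU Ut) as [e [He G]].
    exists (Rmin d e). split; [apply Rmin_pos; assumption|].
    pose proof (Rmin_l d e). pose proof (Rmin_r d e).
    intros u v x y Hu Huv Hv Du Dv Ex Ey.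
    apply seg_weaken with (fun _ => U); [|apply G; auto; lra].
    intros s q Hs Uq. apply HUP; [|exact Uq].
    apply Rabs_def2 in Du. apply Rabs_def2 in Dv. apply Rabs_def1; lra. }
  set (E := fun v => 0 <= v <= 1 /\ (v = 0 \/ forall y, p y = g v -> seg p P 0 v a y)).
  destruct (exists_sup E 0 1) as [m [Hm [Hub Hs]]].
  { intros s Es. apply Es. }
  { exists 0. split; [lra | auto]. }
  destruct (Hloc m Hm) as [d [Hd G]]. destruct (Hs d Hd) as [s [[Hs01 Es] Hsm]].
  pose proof (Hub s (conj Hs01 Es)) as Hle.
  assert (Hext : forall v y, s < v -> v <= 1 -> Rabs (v - m) < d -> p y = g v ->
    seg p P 0 v a y).
  { intros v y Hsv Hv Dv Ey.
    assert (Ds : Rabs (s - m) < d) by (rewrite Rabs_left1; lra).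
    destruct Es as [->|Es]; [apply G; auto; lra|].
    destruct (collapse_surj X n A (g s)) as [z Ez].
    apply seg_concat with s z; [lra | apply Es, Ez | apply G; auto; lra]. }
  destruct (Rlt_dec m 1) as [Hm1|Hm1].
  - exfalso. set (v := Rmin 1 (m + d / 2)).
    assert (m < v /\ v <= 1 /\ v <= m + d / 2) as [V1 [V2 V3]].
    { split; [apply Rmin_glb_lt; lra | split; [apply Rmin_l | apply Rmin_r]]. }
    assert (E v); [|pose proof (Hub v H); lra].
    split; [lra|]. right. intros y. apply Hext; try lra. rewrite Rabs_pos_eq; lra.
  - assert (m = 1) by lra. subst m. destruct (Rlt_dec s 1) as [Hs1|Hs1].
    + apply Hext; auto; [lra|]. rewrite Rminus_diag, Rabs_R0. exact Hd.
    + assert (s = 1) by lra. subst s. destruct Es as [Es|Es]; [lra | auto].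
Qed.

Lemma collapse_pstar_dense (X : Top) (n : nat) (A : nat -> X -> Prop) (a : X)
  (U : pi1_top (collapse_top X n A) (collapse_proj X n A a) -> Prop) :
  locally_segmented X n A -> is_open U -> (exists c, U c) ->
  exists c, U (collapse_pstar X n A a c).
Proof.
  intros HL HU [c Uc]. rewrite <- (qproj_qrep _ c) in Uc.
  set (g := qrep c : loop _ _) in *.
  destruct (loop_top_nbhd _ g HU Uc) as [P [Ploc PO]].
  assert (Hg : path_on 0 1 (fun t => lpath g (clamp t))).
  { intros t V _ HV Vt. destruct (clamp_nbhd _ t V (lcont _ _ g) HV Vt) as [d [Hd H]].
    exists d. auto. }
  assert (E0 : clamp 0 = I0) by apply (clamp_proj I0).
  assert (E1 : clamp 1 = I1) by apply (clamp_proj I1).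
  destruct (seg_global X n A a a _ P HL Hg) as [f [H [C [F0 [F1 [D [H0 [He H1]]]]]]]].
  - rewrite E0. symmetry. apply lstart.
  - rewrite E1. symmetry. apply lend.
  - intros t Ht. destruct (Ploc (clamp t)) as [V [d HV]]. rewrite clamp_in in HV by exact Ht.
    exists V, d. exact HV.
  - pose (alpha := mkLoop X a _ (path_on_continuous f C) F0 F1).
    assert (D1 : path_on 0 1 (fun s => H s 1)).
    { intros s V Hs HV Vs. destruct (D s 1 V Hs ltac:(lra) HV Vs) as [d [Hd G]].
      exists d. split; [exact Hd|]. intros s' Hs' Ds. apply G; auto; [lra|].
      rewrite Rminus_diag, Rabs_R0. exact Hd. }
    (* The final stage of the homotopy: [beta] lies in the given neighbourhood of [g] and represents
       the same class as the projection of [alpha]. *)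
    pose (beta := mkLoop _ (collapse_proj X n A a) _ (path_on_continuous _ D1)
      (proj1 (He 1 ltac:(lra))) (proj2 (He 1 ltac:(lra)))).
    exists (qproj loop_homotopic alpha). unfold collapse_pstar. rewrite pi1_map_qproj.
    replace (qproj loop_homotopic _) with (qproj loop_homotopic beta).
    + apply PO. intros t. apply H1, (proj2_sig t).
    + symmetry. apply qproj_eq, rst_step.
      exists (fun q => H (proj1_sig (fst q)) (proj1_sig (snd q))).
      split; [exact (homotopy_on_continuous H D)|].
      split; [intros s; apply H0, (proj2_sig s)|]. split; [reflexivity|].
      intros t. apply He, (proj2_sig t).
Qed.

Theorem theorem4p4 (X : Top) (n : nat) (A : nat -> X -> Prop) (a : X) :
  condition_star X n A ->
  (exists i, (i < n)%nat /\ A i a) ->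
  compact_space (pi1_top X a) ->
  hausdorff (pi1_top (collapse_top X n A) (collapse_proj X n A a)) ->
  surjective_map (collapse_pstar X n A a) /\
  closed_map (collapse_pstar X n A a) /\
  quotient_map (collapse_pstar X n A a).
Proof.
  intros Hstar _ HK HH.
  assert (Hc : continuous (collapse_pstar X n A a)) by apply pi1_map_continuous.
  assert (Hcl : closed_map (collapse_pstar X n A a))
    by (apply closed_map_of_compact_hausdorff; assumption).
  assert (Hs : surjective_map (collapse_pstar X n A a)).
  { intros c. apply NNPP. intros Hn.
    (* The complement of the image is open because the map is closed; if it were nonempty, density
       would put a point of the image into it. *)
    destruct (collapse_pstar_dense X n A a
      (fun y => ~ exists x, True /\ collapse_pstar X n A a x = y)) as [b Hb].
    - apply locally_segmented_star, Hstar.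
    - apply (Hcl (fun _ => True)). unfold is_closed.
      apply open_of_nbhds. intros x Hx. tauto.
    - exists c. intros [x [_ Hx]]. eauto.
    - apply Hb. eauto. }
  split; [exact Hs|]. split; [exact Hcl|]. apply quotient_map_of_closed; assumption.
Qed.
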